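(* Let $(L,B)$ be a finite-dimensional metric $3$-Lie algebra over $F$. Then there exists a symplectic structure $\omega$ on $L$ if and only if there exists an invertible derivation $D$ of $L$ that is skew-symmetric with respect to $B$, i.e. an invertible $D\in Der_B(L)$.
   Context: $F$ is an algebraically closed field of characteristic zero. A $3$-Lie algebra over $F$ is an $F$-vector space $L$ with a trilinear, totally skew-symmetric bracket $[\cdot,\cdot,\cdot]:L\times L\times L\to L$ satisfying $[[x_1,x_2,x_3],y_2,y_3]=[[x_1,y_2,y_3],x_2,x_3]+[x_1,[x_2,y_2,y_3],x_3]+[x_1,x_2,[x_3,y_2,y_3]]$ for all elements. A derivation of $L$ is a linear map $D:L\to L$ with $D[x,y,z]=[Dx,y,z]+[x,Dy,z]+[x,y,Dz]$ for all $x,y,z$; $Der(L)$ is the set of derivations. A metric on $L$ is a non-degenerate symmetric bilinear form $B:L\times L\to F$ with $B([x_1,x_2,x_3],x_4)+B(x_3,[x_1,x_2,x_4])=0$ for all $x_i\in L$; then $(L,B)$ is a metric $3$-Lie algebra. Put $Der_B(L)=\{D\in Der(L)\mid B(Dx,y)+B(x,Dy)=0\ \forall x,y\in L\}$. A symplectic structure on $L$ is a non-degenerate skew-symmetric bilinear form $\omega:L\times L\to F$ with $$\omega([x_2,x_3,x_4],x_1)-\omega([x_1,x_3,x_4],x_2)+\omega([x_1,x_2,x_4],x_3)-\omega([x_1,x_2,x_3],x_4)=0$$ for all $x_1,x_2,x_3,x_4\in L$. *)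

(* Defs.v *)
From HB Require Import structures.
From mathcomp Require Import all_boot all_order all_algebra.

Set Implicit Arguments.
Unset Strict Implicit.
Unset Printing Implicit Defensive.

Import GRing.Theory.
Local Open Scope ring_scope.

Section ThreeLie.

Variables (F : fieldType) (L : vectType F).
Implicit Types (br : L -> L -> L -> L) (D : 'End(L)).

Definition trilinear br : Prop :=
  [/\ forall y z, linear (fun x => br x y z),
      forall x z, linear (fun y => br x y z)
    & forall x y, linear (fun z => br x y z)].

Definition totally_skew br : Prop :=
  [/\ forall x y z, br y x z = - br x y z,
      forall x y z, br x z y = - br x y z
    & forall x y z, br z y x = - br x y z].

Definition fundamental_identity br : Prop :=
  forall x1 x2 x3 y2 y3,
    br (br x1 x2 x3) y2 y3
    = br (br x1 y2 y3) x2 x3 + br x1 (br x2 y2 y3) x3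
      + br x1 x2 (br x3 y2 y3).

Definition is_3lie br : Prop :=
  [/\ trilinear br, totally_skew br & fundamental_identity br].

Definition is_derivation br D : Prop :=
  forall x y z, D (br x y z) = br (D x) y z + br x (D y) z + br x y (D z).

Definition is_metric br (B : {symmetric L}) : Prop :=
  nondegenerate B /\
  forall x1 x2 x3 x4, B (br x1 x2 x3) x4 + B x3 (br x1 x2 x4) = 0.

Definition is_der_metric br (B : {symmetric L}) D : Prop :=
  is_derivation br D /\ forall x y, B (D x) y + B x (D y) = 0.

(* Named so as not to clash with the library's [is_symplectic], which only
   speaks of the form and not of the bracket. *)
Definition is_symplectic_structure br (w : {skew_symmetric L}) : Prop :=
  nondegenerate w /\
  forall x1 x2 x3 x4,
    w (br x2 x3 x4) x1 - w (br x1 x3 x4) x2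
    + w (br x1 x2 x4) x3 - w (br x1 x2 x3) x4 = 0.

End ThreeLie.

(* Main.v *)
Require Import Defs.
From HB Require Import structures.
From mathcomp Require Import all_boot all_order all_algebra.

Set Implicit Arguments.
Unset Strict Implicit.
Unset Printing Implicit Defensive.

Import GRing.Theory.
Local Open Scope ring_scope.

(** A symplectic structure and a skew invertible derivation are the same object
    seen through the metric: they determine each other by w x y = B x (D y).

    A nondegenerate form identifies L with its dual, so every bilinear form w
    arises from exactly one endomorphism D ([nondegenerate_represents]). Under
    this correspondence the symmetry of B turns skew-symmetry of w into
    skewness of D with respect to B ([skew_symmetric_of_skew_operator] for the
    converse construction), and nondegeneracy of w into bijectivity of D
    ([nondegenerate_comp]).

    The remaining point is that closedness of w means that D is a derivation.
    Invariance of B and skewness of the bracket make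
    P (x1, x2, x3, x4) = B (br x1 x2 x3) x4 totally skew, and D extends to P as
    a derivation by summing over the four slots. After sorting the arguments,
    the closedness condition for w says that this sum vanishes. Moving D from
    the last slot to the bracket by skewness, the sum becomes the pairing of
    the failure of the Leibniz rule at (x1, x2, x3) with x4
    ([cocycle_defect]). As B is nondegenerate, one vanishes identically exactly
    when the other does ([cocycle_derivation]). *)

Lemma nondegenerateP (F : fieldType) (eps : bool) (theta : {rmorphism F -> F})
    (L : vectType F) (f : {hermitian L for eps & theta}) :
  reflect (forall x, (forall y, f x y = 0) -> x = 0) (nondegenerate f).
Proof.
apply: (iffP eqP) => [rad0 x fx0|inj].
  by apply/eqP; rewrite -memv0 -rad0; apply/mem_orthovP => y _.
apply/eqP; rewrite -subv0; apply/subvP => x /mem_orthovP fx0.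
by rewrite memv0 (inj x) // => y; apply: fx0; rewrite memvf.
Qed.

(** The musical map L -> L^* of a bilinear form; the field is viewed as the
    module F^o over itself, which makes the dual a vector space of the same
    dimension as L. *)
Definition flat (F : fieldType) (eps : bool) (L : vectType F)
    (f : {hermitian L for eps & idfun}) (y : L) : 'Hom(L, F^o) :=
  linfun (applyr f y : L -> F^o).

Lemma flatE (F : fieldType) (eps : bool) (L : vectType F)
    (f : {hermitian L for eps & idfun}) (x y : L) : flat f y x = f x y.
Proof. by rewrite lfunE. Qed.

Lemma flat_is_linear (F : fieldType) (eps : bool) (L : vectType F)
    (f : {hermitian L for eps & idfun}) : linear (flat f).
Proof.
by move=> a y z; apply/lfunP => x; rewrite add_lfunE scale_lfunE !lfunE /= linearPr.
Qed.

HB.instance Definition _ (F : fieldType) (eps : bool) (L : vectType F)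
    (f : {hermitian L for eps & idfun}) :=
  GRing.isLinear.Build F L 'Hom(L, F^o) _ (flat f) (flat_is_linear f).

(** Riesz representation: by dimension count the injective musical map of f is
    onto the dual, so D can be taken to be the musical map of g followed by the
    inverse of that of f. *)
Lemma nondegenerate_represents (F : fieldType) (eps eta : bool)
    (L : vectType F) (f : {hermitian L for eps & idfun})
    (g : {hermitian L for eta & idfun}) :
  nondegenerate f -> exists D : 'End(L), forall x y, g x y = f x (D y).
Proof.
move=> /nondegenerateP nf.
have [phi phiE] : exists phi : 'Hom(L, 'Hom(L, F^o)), phi =1 flat f.
  by exists (linfun (flat f)) => y; rewrite lfunE.
have ker0 : lker phi = 0%VS.
  apply/eqP; rewrite -subv0; apply/subvP => y; rewrite memv_ker memv0 phiE.
  move=> /eqP fy0; apply/eqP/nf => x.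
  by apply/eqP; rewrite herm_eq0C -flatE fy0 zero_lfunE.
have full : limg phi = fullv.
  apply/eqP; rewrite eqEdim subvf limg_dim_eq ?ker0 ?capv0 //.
  by rewrite !dimvf /dim /= muln1.
(* phi is onto, hence phi (phi^-1 v) = v for every v *)
exists (phi^-1 \o linfun (flat g))%VF => x y.
by rewrite -!flatE comp_lfunE -phiE limg_lfunVK ?full ?memvf // [linfun _ y]lfunE.
Qed.

(** The radical of g is the kernel of D; injectivity suffices in one direction
    because L has finite dimension. *)
Lemma nondegenerate_comp (F : fieldType) (eps eta : bool)
    (L : vectType F) (f : {hermitian L for eps & idfun})
    (g : {hermitian L for eta & idfun}) (D : 'End(L)) :
  (forall x y, g x y = f x (D y)) -> nondegenerate f ->
  nondegenerate g <-> bijective D.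
Proof.
move=> gE /nondegenerateP nf; split=> [/nondegenerateP ng|[D' _ D'K]].
  have kerD : lker D == 0%VS.
    rewrite -subv0; apply/subvP => y; rewrite memv_ker memv0 => /eqP Dy0.
    by apply/eqP/ng => x; apply/eqP; rewrite herm_eq0C gE Dy0 linear0r.
  by exists (D^-1)%VF; [apply: lker0_lfunK|apply: lker0_lfunVK].
apply/nondegenerateP => x gx0; apply: nf => y.
by rewrite -[y]D'K -gE.
Qed.

Lemma symC (F : fieldType) (L : vectType F) (B : {symmetric L}) (x y : L) :
  B x y = B y x.
Proof. by rewrite hermC expr0 mul1r. Qed.

(** The two sides agree term by term: invariance of the metric exchanges D xi
    with the last bracket argument x4, and skewness of the bracket then returns
    D xi to the i-th slot. The last term on the left gives the D (br x1 x2 x3)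
    part. *)
Lemma cocycle_defect (F : fieldType) (L : vectType F) (br : L -> L -> L -> L)
    (B : {symmetric L}) (D : 'End(L)) :
  totally_skew br ->
  (forall x1 x2 x3 x4, B (br x1 x2 x3) x4 + B x3 (br x1 x2 x4) = 0) ->
  (forall x y, B (D x) y + B x (D y) = 0) ->
  forall x1 x2 x3 x4,
    B (br x2 x3 x4) (D x1) - B (br x1 x3 x4) (D x2)
    + B (br x1 x2 x4) (D x3) - B (br x1 x2 x3) (D x4)
    = B (D (br x1 x2 x3) - (br (D x1) x2 x3 + br x1 (D x2) x3
                            + br x1 x2 (D x3))) x4.
Proof.
move=> [skew12 skew23 _] invB skewD x1 x2 x3 x4.
(* invariance as an exchange rule for the third bracket argument *)
have invE u v y z : B (br u v y) z = - B (br u v z) y.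
  by apply/eqP; rewrite -addr_eq0 [B (br u v z) y]symC invB.
have skewDE x y : B x (D y) = - B (D x) y.
  by apply/eqP; rewrite -addr_eq0 addrC skewD.
rewrite [B (br x1 x2 x3) (D x4)]skewDE opprK.
rewrite (invE x2 x3) (invE x1 x3) (invE x1 x2 x4).
(* D x1 passes two arguments, D x2 only one, and D x3 is in place *)
rewrite [br x2 x3 _]skew23 [br x2 _ x3]skew12 [br x1 x3 _]skew23.
by rewrite !linearNl !opprK linearBl !linearDl !opprD addrC !addrA.
Qed.

Lemma cocycle_derivation (F : fieldType) (L : vectType F)
    (br : L -> L -> L -> L) (B : {symmetric L}) (D : 'End(L)) :
  totally_skew br -> is_metric br B ->
  (forall x y, B (D x) y + B x (D y) = 0) ->
  (forall x1 x2 x3 x4,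
    B (br x2 x3 x4) (D x1) - B (br x1 x3 x4) (D x2)
    + B (br x1 x2 x4) (D x3) - B (br x1 x2 x3) (D x4) = 0)
  <-> is_derivation br D.
Proof.
move=> skew_br [/nondegenerateP nB invB] skewD.
have defect := cocycle_defect skew_br invB skewD.
split=> [cocycle x1 x2 x3|derD x1 x2 x3 x4]; last first.
  by rewrite defect derD subrr linear0l.
apply/eqP; rewrite -subr_eq0; apply/eqP/nB => x4.
by rewrite -defect cocycle.
Qed.

(** Skewness of D combined with symmetry of B gives
    B x (D y) = - B (D x) y = - B y (D x). *)
Lemma skew_symmetric_of_skew_operator (F : fieldType) (L : vectType F)
    (B : {symmetric L}) (D : 'End(L)) :
  (forall x y, B (D x) y + B x (D y) = 0) ->
  exists w : {skew_symmetric L}, forall x y, w x y = B x (D y).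
Proof.
move=> skewD; pose w x y := B x (D y).
have bilin_w : bilinear_for
    (GRing.Scale.Law.clone _ _ *%R _)
    (GRing.Scale.Law.clone _ _ *%R _) w.
  by split=> [y|x] a u v; rewrite /w ?linearP ?linearPl ?linearPr.
have skew_w x y : w x y = (-1) ^+ true * idfun (w y x).
  rewrite expr1 mulN1r /= /w [B y _]symC.
  by apply/eqP; rewrite -addr_eq0 addrC skewD.
pose wB := bilinear_isBilinear.Build F L L F *%R *%R w bilin_w.
pose wH := isHermitianSesquilinear.Build F L true idfun w skew_w.
pose W : {skew_symmetric L} := HB.pack w wB wH.
by exists W.
Qed.

Theorem theorem3p1 (F : closedFieldType) (charF0 : [pchar F] =i pred0)
    (L : vectType F) (br : L -> L -> L -> L) (lie_br : is_3lie br)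
    (B : {symmetric L}) (metric_B : is_metric br B) :
  (exists w : {skew_symmetric L}, is_symplectic_structure br w) <->
  (exists D : 'End(L), is_der_metric br B D /\ bijective D).
Proof.
have [_ skew_br _] := lie_br; have [nB _] := metric_B.
split=> [[w [nw cocycle]]|[D [[derD skewD] bijD]]].
  have [D wE] := nondegenerate_represents w nB.
  have skewD x y : B (D x) y + B x (D y) = 0.
    by rewrite symC -!wE [w y x]hermC expr1 mulN1r addNr.
  exists D; split; last exact/(nondegenerate_comp wE nB).
  split=> //; apply/(cocycle_derivation skew_br metric_B skewD) => x1 x2 x3 x4.
  by rewrite -!wE.
have [w wE] := skew_symmetric_of_skew_operator skewD.
exists w; split; first exact/(nondegenerate_comp wE nB).
move=> x1 x2 x3 x4; rewrite !wE.
by move: x1 x2 x3 x4; apply/(cocycle_derivation skew_br metric_B skewD).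
Qed.
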